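(* Let $z_0 \in \mathbb{D}$. Then there exist two trajectories $w^{\pm}_{z_0} : [0,\infty) \to \mathbb{D}$ of the radial Loewner equation with initial value $z_0$ such that $w^{\pm}_{z_0}([0,\infty))$ is the connected part of the hyperbolic Archimedean spiral $S_h^{\pm}(z_0)$ between $z_0$ and $0$. (a) If $\mathrm{d}_{\mathbb{D}}(0,z_0) \le \pi$, then $w^{\pm}_{z_0}:[0,\infty)\to\mathbb{D}$ is optimal for every $t>0$ and $w^{\pm}_{z_0} ([0,\infty))=\gamma^{\pm}(z_0) \setminus \{0\}$. (b) If $\mathrm{d}_{\mathbb{D}}(0,z_0) > \pi$, then $w^{\pm}_{z_0} :[0,T] \to \mathbb{D}$ is optimal for every $0<T\le T_{max}(z_0)$, but not optimal for any $T>T_{max}(z_0)$. Here $$ T_{max}(z_0)=-\log \left[ \frac{\sinh(\mathrm{d}_{\mathbb{D}}(0,z_0)-\pi)}{\sinh(\mathrm{d}_{\mathbb{D}}(0,z_0))} \right].$$ Furthermore, $w^{\pm}_{z_0}([0,T_{max}(z_0)])=\gamma^{\pm}(z_0)$.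
   Context: $\mathbb{D}=\{z\in\mathbb{C}: |z|<1\}$ is the open unit disk with hyperbolic distance (curvature $-1$) $\mathrm{d}_{\mathbb{D}}$, so $\mathrm{d}_{\mathbb{D}}(0,z)=\log\frac{1+|z|}{1-|z|}$. Here $\arg z_0$ is a fixed real number with $z_0=|z_0|e^{i\arg z_0}$. The radial Loewner equation with initial value $z_0$ is $$\dot{w}(t)=-w(t)\, \frac{\kappa(t)+w(t)}{\kappa(t)-w(t)},\quad t \ge 0,\qquad w(0)=z_0,$$ where $\kappa:[0,\infty)\to\partial\mathbb{D}$ is a continuous function (the control function). A trajectory is a solution $w$ of this equation for some continuous $\kappa:[0,\infty)\to\partial\mathbb{D}$. The reachable set is $$\mathcal{R}(z_0)=\{ w(t) : w \text{ is a trajectory with } w(0)=z_0,\ t\ge 0\}.$$ A trajectory $w:[0,T]\to\mathbb{D}$ is called optimal if $w(T)$ is a boundary point of $\mathcal{R}(z_0)$; ''optimal for every $t>0$'' means that the restriction to $[0,t]$ is optimal for every $t>0$. The hyperbolic Archimedean spirals through $0$ and $z_0$ are the curves $$S_h^+(z_0)=\{ |z| e^{i \varphi} : \mathrm{d}_{\mathbb{D}}(0,z)=\varphi+\mathrm{d}_{\mathbb{D}}(0,z_0)-\arg z_0 , \ \varphi \ge \arg z_0-\mathrm{d}_{\mathbb{D}}(0,z_0)\},$$ $$S_h^-(z_0)=\{ |z| e^{i \varphi} : \mathrm{d}_{\mathbb{D}}(0,z)=-\varphi+\mathrm{d}_{\mathbb{D}}(0,z_0)+\arg z_0 , \ \varphi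 \le \arg z_0+\mathrm{d}_{\mathbb{D}}(0,z_0)\}.$$ Definition of $\gamma^{\pm}(z_0)$: start at $z_0$ and move along $S_h^{\pm}(z_0)$ towards the origin, stopping either when reaching the point $z_1^{\pm}$ of hyperbolic distance $\mathrm{d}_{\mathbb{D}}(0,z_0)-\pi$ from the origin or when reaching the origin. In the first case $\arg z_1^{\pm}=\mp\pi+\arg z_0$, so $z_1:=z_1^+=z_1^-$; in the second case let $z_1:=0$. In both cases $\gamma^{\pm}(z_0)$ is the connected part of $S_h^{\pm}(z_0)$ between $z_0$ and $z_1$ (endpoints included). Explicitly, with $m=\min\{\mathrm{d}_{\mathbb{D}}(0,z_0),\pi\}$, $\gamma^+(z_0)$ is the part of $S_h^+(z_0)$ with parameter $\varphi\in[\arg z_0-m,\arg z_0]$ and $\gamma^-(z_0)$ is the part of $S_h^-(z_0)$ with parameter $\varphi\in[\arg z_0,\arg z_0+m]$. Throughout, statements with $\pm$ hold for each choice of sign.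
   Formalization: In (a), the equality of the image of w^± on [0,∞) with γ^±(z_0)∖{0} is asserted only for z_0 ≠ 0; at z_0 = 0 it fails, since the image is {0} while γ^±(0)∖{0} is empty. All other claims include z_0 = 0. *)

(* Defs.v *)
From Stdlib Require Import Reals Lra.
From Coquelicot Require Import Coquelicot.

Open Scope R_scope.

Inductive pm_sign := Plus | Minus.

Definition expi (phi : R) : C := (cos phi, sin phi).

(* Hyperbolic distance of the unit disk for the metric 2|dz|/(1-|z|^2),
   of curvature -1; only meaningful for z, u in the open unit disk. *)
Definition hyp_dist (z u : C) : R :=
  let rho := Cmod ((z - u) / (1 - Cconj z * u))%C in
  ln ((1 + rho) / (1 - rho)).

Lemma hyp_dist_0 (z : C) :
  hyp_dist 0 z = ln ((1 + Cmod z) / (1 - Cmod z)).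
Proof.
unfold hyp_dist.
replace ((0 - z) / (1 - Cconj 0 * z))%C with (- z)%C.
- now rewrite Cmod_opp.
- assert (H : Cconj 0 = 0%C) by (unfold Cconj; simpl; now rewrite Ropp_0).
  rewrite H.
  replace (1 - 0 * z)%C with (RtoC 1) by ring.
  field.
Qed.

Definition half_line (t : R) : Prop := 0 <= t.

(* Derivative at t relative to [0, +oo): one-sided at t = 0, and the usual
   derivative at t > 0. *)
Definition is_derive_half_line (w : R -> C) (t : R) (l : C) : Prop :=
  filterdiff (K := R_AbsRing) (U := R_NormedModule) (V := C_R_NormedModule)
    w (within half_line (locally t)) (fun h : R => scal h l).

(* Functions on [0, +oo) are modelled by functions on R of which only the
   values at t >= 0 are constrained. The condition |w t| < 1 makes the
   denominator kappa t - w t nonzero. *)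
Definition loewner_solution (kappa : R -> C) (z0 : C) (w : R -> C) : Prop :=
  w 0 = z0 /\
  forall t, 0 <= t ->
    Cmod (w t) < 1 /\
    is_derive_half_line w t
      (- w t * ((kappa t + w t) / (kappa t - w t)))%C.

Definition control (kappa : R -> C) : Prop :=
  continuous_on half_line kappa /\ forall t, 0 <= t -> Cmod (kappa t) = 1.

Definition trajectory (z0 : C) (w : R -> C) : Prop :=
  exists kappa, control kappa /\ loewner_solution kappa z0 w.

Definition reachable (z0 : C) (u : C) : Prop :=
  exists w t, trajectory z0 w /\ 0 <= t /\ u = w t.

Definition boundary_point (E : C -> Prop) (x : C) : Prop :=
  forall P : C -> Prop, locally x P ->
    (exists y, P y /\ E y) /\ (exists y, P y /\ ~ E y).

(* Optimality of the restriction to [0, T] of a trajectory w from z0. *)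
Definition optimal (z0 : C) (w : R -> C) (T : R) : Prop :=
  boundary_point (reachable z0) (w T).

(* u is the point with parameter phi of the hyperbolic Archimedean spiral
   through 0 and z0, where the real number a is the chosen argument of z0. *)
Definition spiral_point (s : pm_sign) (z0 : C) (a phi : R) (u : C) : Prop :=
  exists z : C, Cmod z < 1 /\ u = (Cmod z * expi phi)%C /\
    match s with
    | Plus => hyp_dist 0 z = phi + hyp_dist 0 z0 - a /\
              phi >= a - hyp_dist 0 z0
    | Minus => hyp_dist 0 z = - phi + hyp_dist 0 z0 + a /\
               phi <= a + hyp_dist 0 z0
    end.

(* The arc of the spiral that starts at z0, heads towards the origin, and has
   parameter length L. *)
Definition spiral_arc (s : pm_sign) (z0 : C) (a L : R) (u : C) : Prop :=
  exists phi : R, spiral_point s z0 a phi u /\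
    match s with
    | Plus => a - L <= phi <= a
    | Minus => a <= phi <= a + L
    end.

(* The arc from z0 to 0. As the image of a trajectory, the end point 0 is
   included only when it coincides with the starting point z0. *)
Definition spiral_to_origin (s : pm_sign) (z0 : C) (a : R) (u : C) : Prop :=
  spiral_arc s z0 a (hyp_dist 0 z0) u /\ (u = 0 -> z0 = 0).

Definition gamma (s : pm_sign) (z0 : C) (a : R) : C -> Prop :=
  spiral_arc s z0 a (Rmin (hyp_dist 0 z0) PI).

Definition Tmax (z0 : C) : R :=
  - ln (sinh (hyp_dist 0 z0 - PI) / sinh (hyp_dist 0 z0)).

(* Main.v *)
Require Import Defs.
From Stdlib Require Import Reals Lra Psatz.
From Coquelicot Require Import Coquelicot.
Open Scope R_scope.

(** Write w = |w| e^(i theta), d = d(0, w) and w = kappa |w| e^(i psi).  The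
    equation becomes d' = -2|w| / |kappa - w|^2 and theta' = sin(psi) d', so
    that |theta'| <= -d' along every trajectory: a point at distance x from 0
    can be reached only if some choice of its argument differs from arg z0 by
    at most d(0, z0) - x.  Conversely, a constant psi with sin(psi) = c gives
    the spiral theta = arg z0 + c (d - d(0, z0)), which runs into the origin;
    c = 1 and c = -1 are the two Archimedean spirals.  As long as the angle
    turned on them is at most pi, moving the end point slightly outwards makes
    it unreachable.  As soon as d < d(0, z0) - pi, all points of that disk
    except 0 are reached by spirals with |c| < 1, because every argument has a
    representative within pi of arg z0. *)

(** * Hyperbolic distance to the origin and Euclidean radius *)

Definition hyp_len (r : R) : R := ln ((1 + r) / (1 - r)).

(** This is tanh (x / 2), for x >= 0 the modulus of the points at hyperbolic distance x from 0. *)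
Definition radius (x : R) : R := (exp x - 1) / (exp x + 1).

Lemma hyp_len_radius (x : R) : hyp_len (radius x) = x.
Proof.
unfold hyp_len, radius.
pose proof (exp_pos x).
replace ((1 + (exp x - 1) / (exp x + 1)) / (1 - (exp x - 1) / (exp x + 1)))
  with (exp x) by (field; lra).
apply ln_exp.
Qed.

Lemma radius_hyp_len (r : R) : 0 <= r < 1 -> radius (hyp_len r) = r.
Proof.
intros Hr; unfold radius, hyp_len.
rewrite exp_ln by (apply Rdiv_lt_0_compat; lra).
field; lra.
Qed.

Lemma radius_0 : radius 0 = 0.
Proof. unfold radius; rewrite exp_0; lra. Qed.

Lemma hyp_len_0 : hyp_len 0 = 0.
Proof. rewrite <- radius_0 at 1; apply hyp_len_radius. Qed.

Lemma radius_increasing (x y : R) : x < y -> radius x < radius y.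
Proof.
intros Hxy; unfold radius.
pose proof (exp_pos x); pose proof (exp_increasing x y Hxy).
apply Rminus_lt_0.
replace ((exp y - 1) / (exp y + 1) - (exp x - 1) / (exp x + 1))
  with (2 * (exp y - exp x) / ((exp y + 1) * (exp x + 1))) by (field; lra).
apply Rdiv_lt_0_compat; nra.
Qed.

Lemma radius_pos (x : R) : 0 < x -> 0 < radius x.
Proof. intros Hx; rewrite <- radius_0; now apply radius_increasing. Qed.

Lemma radius_nonneg (x : R) : 0 <= x -> 0 <= radius x.
Proof.
intros [Hx | <-]; [left; now apply radius_pos | rewrite radius_0; lra].
Qed.

Lemma radius_lt_1 (x : R) : radius x < 1.
Proof.
unfold radius; pose proof (exp_pos x).
apply Rlt_div_l; lra.
Qed.

Lemma hyp_len_pos (r : R) : 0 < r < 1 -> 0 < hyp_len r.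
Proof.
intros Hr; unfold hyp_len; rewrite <- ln_1.
apply ln_increasing; [lra |].
apply Rlt_div_r; lra.
Qed.

Lemma hyp_len_nonneg (r : R) : 0 <= r < 1 -> 0 <= hyp_len r.
Proof.
intros [[Hr | <-] Hr1]; [left; apply hyp_len_pos; lra | rewrite hyp_len_0; lra].
Qed.

Lemma hyp_dist_0_len (z : C) : hyp_dist 0 z = hyp_len (Cmod z).
Proof. apply hyp_dist_0. Qed.

Lemma is_derive_radius (x : R) : is_derive radius x ((1 - radius x ^ 2) / 2).
Proof.
pose proof (exp_pos x).
unfold radius; auto_derive; [lra | field; lra].
Qed.

Lemma is_derive_hyp_len (r : R) : -1 < r < 1 -> is_derive hyp_len r (2 / (1 - r ^ 2)).
Proof.
intros Hr; unfold hyp_len; auto_derive.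
- split; [lra | split; [apply Rdiv_lt_0_compat; lra | easy]].
- field; nra.
Qed.

(** * The distance to 0 along a spiral of constant slope *)

Lemma sinh_radius (x : R) : sinh x = 2 * radius x / (1 - radius x ^ 2).
Proof.
unfold sinh, radius; rewrite exp_Ropp; pose proof (exp_pos x).
field; nra.
Qed.

Lemma cosh_radius (x : R) : cosh x = (1 + radius x ^ 2) / (1 - radius x ^ 2).
Proof.
unfold cosh, radius; rewrite exp_Ropp; pose proof (exp_pos x).
field; nra.
Qed.

Lemma sinh_pos (x : R) : 0 < x -> 0 < sinh x.
Proof. intros Hx; rewrite <- sinh_0; now apply sinh_lt. Qed.

(* On a spiral with constant psi, k = cos(psi), the time at which d = x is
   ln (stretch k d0 / stretch k x). *)
Definition stretch (k x : R) : R := sinh x * exp (- k * x).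

Lemma is_derive_stretch (k x : R) :
  is_derive (stretch k) x ((cosh x - k * sinh x) * exp (- k * x)).
Proof.
unfold stretch, sinh, cosh; auto_derive; [easy |].
unfold Rdiv; ring.
Qed.

(** The expression equals (1 - k) / 2 * exp x + (1 + k) / 2 * exp (- x), whose weights are
    nonnegative and not both zero. *)
Lemma cosh_sub_sinh_pos (k x : R) : -1 <= k <= 1 -> 0 < cosh x - k * sinh x.
Proof.
intros Hk; unfold cosh, sinh.
pose proof (exp_pos x); pose proof (exp_pos (- x)); nra.
Qed.

Lemma stretch_increasing (k x y : R) :
  -1 <= k <= 1 -> x < y -> stretch k x < stretch k y.
Proof.
intros Hk Hxy.
destruct (MVT_gen (stretch k) x y
            (fun x => (cosh x - k * sinh x) * exp (- k * x))) as (c & _ & Hc).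
- intros; apply is_derive_stretch.
- intros u _; apply derivable_continuous_pt.
  eexists; apply is_derive_Reals, is_derive_stretch.
- pose proof (cosh_sub_sinh_pos k c Hk); pose proof (exp_pos (- k * c)).
  apply Rminus_lt_0; rewrite Hc.
  apply Rmult_lt_0_compat; [apply Rmult_lt_0_compat; lra | lra].
Qed.

Lemma stretch_injective (k x y : R) :
  -1 <= k <= 1 -> stretch k x = stretch k y -> x = y.
Proof.
intros Hk H; destruct (Rtotal_order x y) as [L | [E | L]]; [| easy |];
  apply (stretch_increasing k) in L; lra.
Qed.

Lemma stretch_0 (k : R) : stretch k 0 = 0.
Proof. unfold stretch; rewrite sinh_0; ring. Qed.

Lemma stretch_pos (k x : R) : 0 < x -> 0 < stretch k x.
Proof.
intros Hx; apply Rmult_lt_0_compat; [now apply sinh_pos | apply exp_pos].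
Qed.

(* For k = 1 this fails: [stretch 1] is bounded by 1/2. *)
Lemma stretch_surjective (k : R) :
  -1 <= k <= 0 -> forall y, {x : R | 0 < y -> 0 < x /\ stretch k x = y}.
Proof.
intros Hk y.
(* For y <= 0 the value 0 is a placeholder that makes the inverse a total function. *)
destruct (Rlt_dec 0 y) as [Hy | Hy]; [| exists 0; tauto].
(* The end point [arcsinh y] is large enough: for k <= 0 and x >= 0 the factor exp (- k x) is at
   least 1, so [stretch k x] is at least sinh x. *)
destruct (IVT_gen_consistent (stretch k) 0 (arcsinh y) y) as [x [_ Hx]].
- intros x; apply (ex_derive_continuous (V := R_NormedModule)).
  eexists; apply is_derive_stretch.
- rewrite stretch_0.
  assert (H0 : 0 < arcsinh y) by (rewrite <- arcsinh_0; now apply arcsinh_lt).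
  assert (H : y <= stretch k (arcsinh y)).
  { unfold stretch; rewrite sinh_arcsinh.
    pose proof (exp_ineq1_le (- k * arcsinh y)).
    assert (0 <= - k * arcsinh y) by nra.
    nra. }
  rewrite Rmin_left, Rmax_right; lra.
- exists x; intros _; split; [| easy].
  destruct (Rlt_or_le 0 x) as [Hp | Hp]; [easy |].
  destruct Hp as [Hp | ->]; [| rewrite stretch_0 in Hx; lra].
  apply (stretch_increasing k) in Hp; [rewrite stretch_0 in Hp; lra | lra].
Qed.

(** The third clause is the integrated form of the differential equation in the fourth. Solving it
    for [d t] by the inverse of [stretch k] defines [d], and the derivative of an inverse function
    then gives the differential equation. *)
Lemma slope_distance (k d0 : R) :
  -1 <= k <= 0 -> 0 < d0 ->
  exists d : R -> R,
    d 0 = d0 /\ (forall t, 0 < d t) /\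
    (forall t, stretch k (d t) = exp (- t) * stretch k d0) /\
    (forall t, is_derive d t (- sinh (d t) / (cosh (d t) - k * sinh (d t)))).
Proof.
intros Hk Hd0.
assert (S0 := stretch_pos k d0 Hd0).
set (g := fun y => proj1_sig (stretch_surjective k Hk y)).
assert (Hg : forall y, 0 < y -> 0 < g y /\ stretch k (g y) = y).
{ intros y; unfold g; now destruct (stretch_surjective k Hk y). }
assert (Hg' : forall x, 0 < x -> g (stretch k x) = x).
{ intros x Hx; apply (stretch_injective k); [lra |].
  now apply Hg, stretch_pos. }
assert (Hlt : forall u v, 0 < u -> 0 < v -> u < v -> g u < g v).
{ intros u v Hu Hv Huv; apply Rnot_le_lt; intros [L | E].
  - apply (stretch_increasing k) in L; [| lra].
    rewrite (proj2 (Hg u Hu)), (proj2 (Hg v Hv)) in L; lra.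
  - apply (f_equal (stretch k)) in E.
    rewrite (proj2 (Hg u Hu)), (proj2 (Hg v Hv)) in E; lra. }
assert (Cg : forall y, 0 < y -> continuity_pt g y).
{ intros y Hy eps Heps.
  destruct (Hg y Hy) as [Hx Hxy].
  (* The inverse is increasing, so [g u] lies between [g y - e] and [g y + e] once [u] lies between
     their images. Since [e < g y], both points are positive, where [g] does invert [stretch k]. *)
  set (e := Rmin eps (g y / 2)).
  assert (He : 0 < e <= eps /\ e < g y).
  { pose proof (Rmin_l eps (g y / 2)); pose proof (Rmin_r eps (g y / 2)).
    unfold e; split; [split; [apply Rmin_pos; lra | easy] | lra]. }
  assert (L1 : stretch k (g y - e) < y).
  { rewrite <- Hxy at 2; apply stretch_increasing; lra. }
  assert (L2 : y < stretch k (g y + e)).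
  { rewrite <- Hxy at 1; apply stretch_increasing; lra. }
  assert (L0 : 0 < stretch k (g y - e)) by (apply stretch_pos; lra).
  exists (Rmin (y - stretch k (g y - e)) (stretch k (g y + e) - y)).
  split; [apply Rmin_pos; lra |].
  intros u [_ Hu]; unfold Rlimit.dist in *; simpl in *; unfold Rdist in *.
  pose proof (Rmin_l (y - stretch k (g y - e)) (stretch k (g y + e) - y)).
  pose proof (Rmin_r (y - stretch k (g y - e)) (stretch k (g y + e) - y)).
  apply Rabs_def2 in Hu.
  assert (G1 : g (stretch k (g y - e)) < g u) by (apply Hlt; lra).
  assert (G2 : g u < g (stretch k (g y + e))) by (apply Hlt; lra).
  rewrite Hg' in G1, G2 by lra.
  apply Rabs_def1; lra. }
assert (Dg : forall y, 0 < y ->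
  is_derive g y (/ ((cosh (g y) - k * sinh (g y)) * exp (- k * g y)))).
{ intros y Hy.
  assert (pr : forall u, derivable_pt (stretch k) u).
  { intros u; eexists; apply is_derive_Reals, is_derive_stretch. }
  (* Any interval of positive numbers around y would do for the inverse function rule. *)
  assert (Hgy : g (y / 2) <= g y <= g (2 * y)).
  { split; left; apply Hlt; lra. }
  assert (E : derive_pt (stretch k) (g y) (pr (g y)) =
              (cosh (g y) - k * sinh (g y)) * exp (- k * g y)).
  { apply derive_pt_eq_0, is_derive_Reals, is_derive_stretch. }
  assert (HC := cosh_sub_sinh_pos k (g y) ltac:(lra)); pose proof (exp_pos (- k * g y)).
  apply is_derive_Reals; rewrite <- E, <- Rdiv_1_l.
  assert (L1 : y / 2 < 2 * y) by lra.
  assert (L2 : y / 2 < y < 2 * y) by lra.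
  apply (Ranalysis5.derivable_pt_lim_recip_interv (stretch k) g (y / 2) (2 * y) y
           (fun u _ => pr u) (Cg y Hy) L1 L2 Hgy).
  - intros u Hu; assert (Hu0 : 0 < u) by lra; exact (proj2 (Hg u Hu0)).
  - rewrite E; nra. }
exists (fun t => g (exp (- t) * stretch k d0)).
assert (Hp : forall t, 0 < exp (- t) * stretch k d0).
{ intros t; apply Rmult_lt_0_compat; [apply exp_pos | easy]. }
split; [rewrite Ropp_0, exp_0, Rmult_1_l; now apply Hg' |].
split; [| split]; intros t; try apply Hg, Hp.
destruct (Hg _ (Hp t)) as [_ Hs].
set (x := g (exp (- t) * stretch k d0)) in *.
assert (De : is_derive (fun t => exp (- t) * stretch k d0) t (- stretch k x)).
{ auto_derive; [easy | rewrite Hs; ring]. }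
evar_last; [apply (is_derive_comp g _ _ _ _ (Dg _ (Hp t)) De) |].
unfold scal; simpl; unfold mult; simpl; fold x.
assert (HC := cosh_sub_sinh_pos k x ltac:(lra)); pose proof (exp_pos (- k * x)).
unfold stretch; field; lra.
Qed.

(** * Derivatives and limits of complex functions on the half-line *)

Lemma half_line_proper (t : R) :
  0 <= t -> ProperFilter (within half_line (locally t)).
Proof.
intros Ht; split; [| apply within_filter, locally_filter].
intros P HP; exists t; apply (locally_singleton _ _ HP Ht).
Qed.

Lemma half_line_filter_lim (t : R) : is_filter_lim (within half_line (locally t)) t.
Proof. intros P HP; now apply filter_le_within. Qed.

Lemma is_derive_half_line_pair (x y : R -> R) (t lx ly : R) :
  0 <= t -> is_derive x t lx -> is_derive y t ly ->
  is_derive_half_line (fun t => (x t, y t)) t (lx, ly).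
Proof.
intros Ht Hx Hy.
pose proof (half_line_proper t Ht).
apply (filterdiff_locally (K := R_AbsRing) (U := R_NormedModule)
         (V := C_R_NormedModule) _ t); [apply half_line_filter_lim |].
apply (filterdiff_comp'_2 (K := R_AbsRing) (T := R_NormedModule) (U := R_NormedModule)
         (V := R_NormedModule) (W := C_R_NormedModule) x y (fun u v => (u, v)) t
         (fun h => scal h lx) (fun h => scal h ly) (fun u v => (u, v)) Hx Hy).
apply (filterdiff_ext (U := C_R_NormedModule) (V := C_R_NormedModule) (fun u => u));
  [now intros [u v] |].
apply (filterdiff_ext_lin (U := C_R_NormedModule) (V := C_R_NormedModule)
         _ (fun u => u)); [apply filterdiff_id | now intros [u v]].
Qed.

(** At t > 0 the half-line is a neighbourhood of t, so the derivative relative to it is the ordinary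
    one. *)
Lemma is_derive_half_line_component (p : C -> R) (w : R -> C) (t : R) (l : C) :
  is_linear (U := C_R_NormedModule) (V := R_NormedModule) p ->
  0 < t -> is_derive_half_line w t l -> is_derive (fun t => p (w t)) t (p l).
Proof.
intros Hp Ht Hw.
assert (H : filterdiff (U := R_NormedModule) (V := R_NormedModule) (fun t => p (w t))
              (within half_line (locally t)) (fun h => p (scal h l))).
{ apply (filterdiff_comp (U := R_NormedModule) (V := C_R_NormedModule)
           (W := R_NormedModule) w p _ p Hw).
  now apply filterdiff_linear. }
assert (Hn : locally t half_line).
{ apply (filter_imp (fun u => 0 < u)); [intros u Hu; now left |].
  now apply (open_gt 0). }
destruct H as [Hl H].
split; [apply is_linear_scal_l |].
intros x Hx eps.
specialize (H x (fun P HP => filter_le_within _ _ (Hx P HP)) eps).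
generalize (filter_and _ _ Hn H); apply filter_imp; intros u [Hu Hd].
rewrite <- (linear_scal _ Hp).
exact (Hd Hu).
Qed.

Lemma Cmod_polar (r phi : R) : 0 <= r -> Cmod (r * expi phi) = r.
Proof.
intros Hr; rewrite Cmod_mult, Cmod_R, Rabs_pos_eq by easy.
unfold expi, Cmod; simpl.
replace (cos phi * (cos phi * 1) + sin phi * (sin phi * 1)) with 1.
- rewrite sqrt_1; ring.
- pose proof (sin2_cos2 phi); unfold Rsqr in *; lra.
Qed.

Lemma polar_pair (r phi : R) : (r * expi phi)%C = (r * cos phi, r * sin phi).
Proof. unfold expi, Cmult; simpl; f_equal; ring. Qed.

Lemma is_derive_half_line_polar (r phi : R -> R) (t r' phi' : R) :
  0 <= t -> is_derive r t r' -> is_derive phi t phi' ->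
  is_derive_half_line (fun t => (r t * expi (phi t))%C) t
    ((r', (r t * phi')%R) * expi (phi t))%C.
Proof.
intros Ht Hr Hphi.
assert (Hx : is_derive (fun t => r t * cos (phi t)) t
               (r' * cos (phi t) - r t * phi' * sin (phi t))).
{ auto_derive; [repeat split; eexists; eassumption |].
  rewrite (is_derive_unique (fun t : R => r t) _ _ Hr),
    (is_derive_unique (fun t : R => phi t) _ _ Hphi); ring. }
assert (Hy : is_derive (fun t => r t * sin (phi t)) t
               (r' * sin (phi t) + r t * phi' * cos (phi t))).
{ auto_derive; [repeat split; eexists; eassumption |].
  rewrite (is_derive_unique (fun t : R => r t) _ _ Hr),
    (is_derive_unique (fun t : R => phi t) _ _ Hphi); ring. }
apply (filterdiff_ext (U := R_NormedModule) (V := C_R_NormedModule)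
         (fun t => (r t * cos (phi t), r t * sin (phi t)))).
- intros u; symmetry; apply polar_pair.
- exact (is_derive_half_line_pair _ _ _ _ _ Ht Hx Hy).
Qed.

Lemma filterlim_C_pair (T : Type) (F : (T -> Prop) -> Prop) (x y : T -> R) (lx ly : R) :
  Filter F -> filterlim x F (locally lx) -> filterlim y F (locally ly) ->
  filterlim (fun t => (x t, y t)) F (locally (T := C_UniformSpace) (lx, ly)).
Proof.
intros FF Hx Hy P [eps He].
assert (H : F (fun t => ball lx eps (x t) /\ ball ly eps (y t))).
{ apply filter_and; [exact (Hx _ (locally_ball lx eps)) | exact (Hy _ (locally_ball ly eps))]. }
unfold filtermap; revert H; apply filter_imp; intros t [Bx By]; apply He; now split.
Qed.

(** * Spirals as solutions of the Loewner equation *)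

Lemma Cdiv_unique (x y p : C) : y <> 0 -> x = (p * y)%C -> (x / y)%C = p.
Proof. intros Hy ->; field; exact Hy. Qed.

(** With c = sin(psi) and k = cos(psi), the control is e^(i (phi - psi)) and the point is r e^(i
    phi). The common rotation cancels, and 1 - 2 k r + r^2 is |kappa - w|^2. *)
Lemma loewner_quotient (r c k phi : R) :
  c ^ 2 + k ^ 2 = 1 -> 0 <= r < 1 ->
  ((expi phi * (k, (- c)%R) + r * expi phi) / (expi phi * (k, (- c)%R) - r * expi phi))%C =
  ((1 - r ^ 2) / (1 - 2 * k * r + r ^ 2), 2 * r * c / (1 - 2 * k * r + r ^ 2)).
Proof.
intros Hck Hr.
assert (Hk : k <= 1) by nra.
assert (HN : 0 < 1 - 2 * k * r + r ^ 2) by nra.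
assert (Hne : (expi phi * (k, (- c)%R) - r * expi phi)%C <> 0).
{ intros H.
  assert (H2 : Cmod (expi phi * ((k - r)%R, (- c)%R)) = 0).
  { rewrite <- Cmod_0, <- H; f_equal.
    unfold expi, Cmult, Cminus, Cplus, Copp; simpl; f_equal; ring. }
  rewrite Cmod_mult in H2.
  rewrite <- (Cmult_1_l (expi phi)), Cmod_polar in H2 by lra.
  rewrite Rmult_1_l in H2; apply Cmod_eq_0 in H2.
  injection H2; intros; nra. }
apply Cdiv_unique; [exact Hne |].
unfold expi, Cmult, Cminus, Cplus, Copp; simpl.
f_equal; field_simplify_eq; try lra;
  replace (k ^ 2) with (1 - c ^ 2) by lra; ring.
Qed.

(* Here c = sin(psi) and k = cos(psi). *)
Lemma slope_trajectory (z0 : C) (a c k d0 : R) (d : R -> R) :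
  0 <= Cmod z0 < 1 -> z0 = (Cmod z0 * expi a)%C -> hyp_len (Cmod z0) = d0 ->
  c ^ 2 + k ^ 2 = 1 -> k <= 0 -> d 0 = d0 -> (forall t, 0 < d t) ->
  (forall t, is_derive d t (- sinh (d t) / (cosh (d t) - k * sinh (d t)))) ->
  trajectory z0 (fun t => (radius (d t) * expi (a + c * (d t - d0)))%C).
Proof.
intros Hz Ha Ed0 Hck Hk0 Hd0 Hp Dd.
assert (Hk : -1 <= k <= 0) by (split; nra).
set (phi := fun t => a + c * (d t - d0)).
(* The control is e^(i (phi t - psi)), which keeps w = kappa |w| e^(i psi). *)
exists (fun t => (expi (phi t) * (k, (- c)%R))%C).
assert (Hr : forall t, 0 < radius (d t) < 1).
{ intros t; split; [now apply radius_pos | apply radius_lt_1]. }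
split; [split | split].
- intros t Ht.
  eapply filterlim_filter_le_1; [apply filter_le_within |].
  unfold expi, Cmult; simpl.
  apply filterlim_C_pair; [apply locally_filter | |];
    match goal with |- filterlim ?f _ _ => change (continuous f t) end;
    apply (ex_derive_continuous (V := R_NormedModule));
    unfold phi; auto_derive; repeat split; eexists; apply Dd.
- intros t Ht.
  rewrite Cmod_mult, <- (Cmult_1_l (expi (phi t))), Cmod_polar by lra.
  unfold Cmod; simpl; rewrite Rmult_1_l.
  transitivity (sqrt 1); [f_equal; nra | apply sqrt_1].
- rewrite Hd0, Rminus_diag, Rmult_0_r, Rplus_0_r, <- Ed0, radius_hyp_len by easy.
  now symmetry.
- intros t Ht; fold (phi t); specialize (Hr t); split.
  + rewrite Cmod_polar; lra.
  + rewrite loewner_quotient, !polar_pair by lra.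
    set (N := 1 - 2 * k * radius (d t) + radius (d t) ^ 2).
    assert (HN : 0 < N) by (unfold N; nra).
    (* With r = [radius (d t)], the expressions of sinh and cosh through tanh of the half argument
       turn the rate into -2 r / |kappa - w|^2. *)
    assert (Dd' : is_derive d t (- (2 * radius (d t)) / N)).
    { evar_last; [apply Dd |].
      rewrite sinh_radius, cosh_radius; unfold N; field.
      split; nra. }
    assert (Dr : is_derive (fun t => radius (d t)) t
                   (- (2 * radius (d t)) / N * ((1 - radius (d t) ^ 2) / 2))).
    { apply (is_derive_comp radius d); [apply is_derive_radius | apply Dd']. }
    assert (Dphi : is_derive phi t (c * (- (2 * radius (d t)) / N))).
    { unfold phi; evar_last.
      - apply (is_derive_plus (K := R_AbsRing) (V := R_NormedModule));
          [apply is_derive_const |].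
        apply is_derive_scal, (is_derive_minus (K := R_AbsRing) (V := R_NormedModule));
          [apply Dd' | apply is_derive_const].
      - unfold plus, minus, zero, opp; simpl; unfold plus; simpl; ring. }
    evar_last; [apply (is_derive_half_line_polar _ phi _ _ _ Ht Dr Dphi) |].
    unfold Cmult, Copp, expi; simpl; f_equal; field; lra.
Qed.

(** * A priori bounds for arbitrary trajectories *)

(** Clamping the time at 0 is 1-Lipschitz and lands in the half-line. The extended function is
    continuous on all of R and can be integrated there. *)
Lemma continuous_on_half_line_Rmax (U : UniformSpace) (f : R -> U) (t : R) :
  continuous_on half_line f -> continuous (fun t => f (Rmax 0 t)) t.
Proof.
intros Hf.
apply filterlim_comp with (G := within half_line (locally (Rmax 0 t)));
  [| apply Hf, Rmax_l].
intros P [eps HP]; exists eps; intros u Hu; apply HP; [| apply Rmax_l].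
apply Rle_lt_trans with (2 := Hu).
unfold abs, minus, plus, opp; simpl.
unfold Rmax, Rabs; repeat destruct Rle_dec; repeat destruct Rcase_abs; lra.
Qed.

(** The derivative is required only inside the interval because a clamped trajectory need not be
    differentiable at 0. *)
Lemma zero_derive_constant (f : R -> R) (t : R) :
  0 <= t -> (forall u, 0 < u < t -> is_derive f u 0) ->
  (forall u, continuous f u) -> f t = f 0.
Proof.
intros Ht Hd Hc.
destruct (MVT_gen f 0 t (fun _ => 0)) as (c & _ & H).
- rewrite Rmin_left, Rmax_right by easy; exact Hd.
- intros u _; apply continuity_pt_filterlim, Hc.
- lra.
Qed.

Lemma nonpos_derive_le (f df : R -> R) (t : R) :
  0 <= t -> (forall u, 0 <= u <= t -> is_derive f u (df u) /\ df u <= 0) ->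
  f t <= f 0.
Proof.
intros Ht Hd.
destruct (MVT_gen f 0 t df) as (c & Hc & H);
  rewrite ?Rmin_left, ?Rmax_right in * by easy.
- intros u Hu; apply Hd; lra.
- intros u Hu; apply continuity_pt_filterlim.
  apply (ex_derive_continuous (V := R_NormedModule)).
  eexists; apply Hd; lra.
- destruct (Hd c Hc); nra.
Qed.

(** For |k| = 1 this is the Poisson kernel, the real part of (k + w) / (k - w); [loewner_im] is the
    conjugate kernel. *)
Definition loewner_re (k w : C) : R :=
  (1 - (fst w ^ 2 + snd w ^ 2)) / ((fst k - fst w) ^ 2 + (snd k - snd w) ^ 2).

Definition loewner_im (k w : C) : R :=
  2 * (snd w * fst k - fst w * snd k) /
    ((fst k - fst w) ^ 2 + (snd k - snd w) ^ 2).

Lemma Cmod_sqr (z : C) : Cmod z ^ 2 = fst z ^ 2 + snd z ^ 2.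
Proof. unfold Cmod; rewrite <- Rsqr_pow2, Rsqr_sqrt; [easy | nra]. Qed.

Lemma unit_circle_sub_disk (k w : C) :
  Cmod k = 1 -> Cmod w < 1 -> 0 < (fst k - fst w) ^ 2 + (snd k - snd w) ^ 2.
Proof.
intros Hk Hw.
assert (H : (fst k - fst w) ^ 2 + (snd k - snd w) ^ 2 = Cmod (k - w) ^ 2).
{ rewrite Cmod_sqr; easy. }
rewrite H; apply pow_lt, Cmod_gt_0; intros E.
assert (k = w) by (replace k with (k - w + w)%C by ring; rewrite E; ring).
subst; lra.
Qed.

Lemma loewner_quotient_re_im (k w : C) :
  Cmod k = 1 -> Cmod w < 1 ->
  ((k + w) / (k - w))%C = (loewner_re k w, loewner_im k w).
Proof.
intros Hk Hw.
pose proof (unit_circle_sub_disk k w Hk Hw) as HN.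
assert (Hk2 := Cmod_sqr k); rewrite Hk in Hk2.
destruct k as [k1 k2], w as [x y]; unfold loewner_re, loewner_im; simpl in *.
apply Cdiv_unique.
- intros E; injection E; intros; nra.
- unfold Cmult, Cplus, Cminus, Copp; simpl.
  pose proof (f_equal (Rmult (k1 - x)) Hk2); pose proof (f_equal (Rmult (k2 - y)) Hk2).
  f_equal; field_simplify_eq; lra.
Qed.

(** This is |theta'| <= -d' with the denominators cleared. It reduces to |Im (w conj(k))| <= |w|. *)
Lemma loewner_im_le_re (k w : C) :
  Cmod k = 1 -> Cmod w < 1 ->
  Rabs (loewner_im k w) * (1 - Cmod w ^ 2) <= 2 * Cmod w * loewner_re k w.
Proof.
intros Hk Hw.
pose proof (unit_circle_sub_disk k w Hk Hw) as HN.
assert (Hk2 := Cmod_sqr k); rewrite Hk in Hk2.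
assert (Hw2 := Cmod_sqr w); assert (H0 := Cmod_ge_0 w).
unfold loewner_re, loewner_im; rewrite <- Hw2.
set (N := _ + _) in *; set (v := snd w * fst k - fst w * snd k).
assert (Hv : Rabs v <= Cmod w).
{ rewrite <- (Rabs_pos_eq (Cmod w)) by easy.
  apply Rsqr_le_abs_0; unfold Rsqr.
  (* Lagrange's identity for the vectors w and kappa, with |kappa| = 1. *)
  replace (Cmod w * Cmod w) with (v * v + (fst w * fst k + snd w * snd k) ^ 2).
  - pose proof (pow2_ge_0 (fst w * fst k + snd w * snd k)); lra.
  - transitivity (Cmod w ^ 2 * 1 ^ 2); [rewrite Hw2, Hk2; unfold v |]; ring. }
unfold Rdiv; rewrite !Rabs_mult, (Rabs_pos_eq 2), (Rabs_pos_eq (/ N));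
  [| left; now apply Rinv_0_lt_compat | lra].
apply Rminus_le_0.
replace (_ - _) with (2 * (Cmod w - Rabs v) * (1 - Cmod w ^ 2) * / N) by ring.
repeat apply Rmult_le_pos; try lra; [nra | left; now apply Rinv_0_lt_compat].
Qed.

Ltac solve_continuous :=
  repeat match goal with
    | H : forall t, continuous ?f t |- continuous ?f _ => apply H
    | |- continuous (fun _ => ?c) _ => apply continuous_const
    | |- continuous (fun x => @?f x + @?g x) _ =>
        apply (continuous_plus (V := R_NormedModule) f g)
    | |- continuous (fun x => @?f x - @?g x) _ =>
        apply (continuous_minus (V := R_NormedModule) f g)
    | |- continuous (fun x => @?f x * @?g x) _ =>
        apply (continuous_mult (K := R_AbsRing) f g)
    end.

(** Along a given trajectory the quotient is a known function A + i B of time, so the equation is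
    linear, w' = -(A + i B) w, and is solved by an exponential of the integrals P and Q of A and B.
    This provides a continuous choice of the argument of w. Constant extension to negative times
    gives derivatives of P and Q everywhere. *)
Lemma trajectory_log (z0 : C) (w : R -> C) :
  trajectory z0 w ->
  exists P Q A B : R -> R,
    P 0 = 0 /\ Q 0 = 0 /\
    (forall t, is_derive P t (A t)) /\ (forall t, is_derive Q t (B t)) /\
    forall t, 0 <= t ->
      Cmod (w t) < 1 /\
      w t = (z0 * (exp (- P t) * expi (- Q t)))%C /\
      Rabs (B t) * (1 - Cmod (w t) ^ 2) <= 2 * Cmod (w t) * A t.
Proof.
intros (kappa & [Ck Hk] & H0 & Hw).
set (ke := fun t => kappa (Rmax 0 t)); set (we := fun t => w (Rmax 0 t)).
assert (Hke : forall t, Cmod (ke t) = 1) by (intros t; apply Hk, Rmax_l).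
assert (Hwe : forall t, Cmod (we t) < 1) by (intros t; apply Hw, Rmax_l).
assert (Cke : forall t, continuous ke t).
{ intros t; now apply (continuous_on_half_line_Rmax C_UniformSpace). }
assert (Cwe : forall t, continuous we t).
{ intros t; apply (continuous_on_half_line_Rmax C_UniformSpace).
  intros u Hu; destruct (Hw u Hu) as [_ D].
  apply (filterdiff_continuous_aux (K := R_AbsRing) (U := R_NormedModule)
           (V := C_R_NormedModule)); [eexists; exact D |].
  apply half_line_filter_lim. }
assert (Cf : forall (f : R -> C) (t : R), continuous f t -> continuous (fun t => fst (f t)) t).
{ intros f t Hf; apply (continuous_comp f fst); [easy | apply continuous_fst]. }
assert (Cs : forall (f : R -> C) (t : R), continuous f t -> continuous (fun t => snd (f t)) t).
{ intros f t Hf; apply (continuous_comp f snd); [easy | apply continuous_snd]. }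
set (A := fun t => loewner_re (ke t) (we t)).
set (B := fun t => loewner_im (ke t) (we t)).
assert (Ck1 := fun t => Cf _ t (Cke t)); assert (Ck2 := fun t => Cs _ t (Cke t)).
assert (Cw1 := fun t => Cf _ t (Cwe t)); assert (Cw2 := fun t => Cs _ t (Cwe t)).
assert (CA : forall t, continuous A t).
{ intros t; unfold A, loewner_re, Rdiv, pow.
  apply (continuous_mult (K := R_AbsRing)); [| apply continuous_Rinv_comp].
  - solve_continuous.
  - solve_continuous.
  - apply Rgt_not_eq; exact (unit_circle_sub_disk _ _ (Hke t) (Hwe t)). }
assert (CB : forall t, continuous B t).
{ intros t; unfold B, loewner_im, Rdiv, pow.
  apply (continuous_mult (K := R_AbsRing)); [| apply continuous_Rinv_comp].
  - solve_continuous.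
  - solve_continuous.
  - apply Rgt_not_eq; exact (unit_circle_sub_disk _ _ (Hke t) (Hwe t)). }
assert (DI : forall (f : R -> R) (t : R), (forall t, continuous f t) -> is_derive (RInt f 0) t (f t)).
{ intros f t Cfc; apply (is_derive_RInt (V := R_NormedModule) f _ 0); [| apply Cfc].
  apply filter_forall; intros u.
  apply (RInt_correct (V := R_CompleteNormedModule)), ex_RInt_continuous.
  intros; apply Cfc. }
exists (RInt A 0), (RInt B 0), A, B.
split; [apply (RInt_point (V := R_CompleteNormedModule)) |].
split; [apply (RInt_point (V := R_CompleteNormedModule)) |].
split; [intros; now apply DI |]; split; [intros; now apply DI |].
intros t Ht.
assert (Et : Rmax 0 t = t) by now apply Rmax_right.
split; [now apply Hw |]; split.
2: { pose proof (loewner_im_le_re (ke t) (we t) (Hke t) (Hwe t)) as H.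
     unfold A, B; unfold we at 2 3 in H; now rewrite Et in H. }
set (P := RInt A 0); set (Q := RInt B 0).
assert (DP : forall t, is_derive P t (A t)) by (intros; now apply DI).
assert (DQ : forall t, is_derive Q t (B t)) by (intros; now apply DI).
set (X := fun t => fst (we t)); set (Y := fun t => snd (we t)).
assert (DXY : forall u, 0 < u -> is_derive X u (- (X u * A u - Y u * B u)) /\
                                 is_derive Y u (- (X u * B u + Y u * A u))).
{ intros u Hu.
  assert (Eu : Rmax 0 u = u) by (apply Rmax_right; lra).
  destruct (Hw u (Rlt_le _ _ Hu)) as [Hwu D].
  assert (Eq := loewner_quotient_re_im (ke u) (we u) (Hke u) (Hwe u)).
  fold (A u) (B u) in Eq; unfold ke, we in Eq; rewrite Eu in Eq; rewrite Eq in D.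
  assert (Hn : forall p : C -> R, locally u (fun v => p (w v) = p (we v))).
  { intros p; apply (filter_imp (fun v => 0 < v)); [| now apply (open_gt 0)].
    intros v Hv; unfold we; rewrite Rmax_right by lra; easy. }
  split.
  - apply (is_derive_ext_loc (fun v => fst (w v)) _ _ _ (Hn fst)).
    evar_last; [apply (is_derive_half_line_component _ _ _ _ is_linear_fst Hu D) |].
    unfold X, Y, we; rewrite Eu; simpl; ring.
  - apply (is_derive_ext_loc (fun v => snd (w v)) _ _ _ (Hn snd)).
    evar_last; [apply (is_derive_half_line_component _ _ _ _ is_linear_snd Hu D) |].
    unfold X, Y, we; rewrite Eu; simpl; ring. }
(* U + i V is w e^(P + i Q); its derivative vanishes, so it keeps its initial value z0. *)
set (U := fun t => exp (P t) * (X t * cos (Q t) - Y t * sin (Q t))).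
set (V := fun t => exp (P t) * (X t * sin (Q t) + Y t * cos (Q t))).
assert (CX : forall t, continuous X t) by (intros; now apply Cf).
assert (CY : forall t, continuous Y t) by (intros; now apply Cs).
assert (CP : forall t, continuous P t).
{ intros; apply (ex_derive_continuous (V := R_NormedModule)); eexists; apply DP. }
assert (CQ : forall t, continuous Q t).
{ intros; apply (ex_derive_continuous (V := R_NormedModule)); eexists; apply DQ. }
assert (CE := fun u => continuous_exp_comp P u (CP u)).
assert (CC := fun u => continuous_cos_comp Q u (CQ u)).
assert (CS := fun u => continuous_sin_comp Q u (CQ u)).
assert (EU : U t = U 0).
{ apply zero_derive_constant; [easy | | intros u; unfold U; solve_continuous].
  intros u Hu; destruct (DXY u (proj1 Hu)) as [DX DY].
  unfold U; auto_derive; [repeat split; eexists; eauto |].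
  rewrite (is_derive_unique (fun x : R => P x) _ _ (DP u)),
    (is_derive_unique (fun x : R => Q x) _ _ (DQ u)),
    (is_derive_unique (fun x : R => X x) _ _ DX),
    (is_derive_unique (fun x : R => Y x) _ _ DY); ring. }
assert (EV : V t = V 0).
{ apply zero_derive_constant; [easy | | intros u; unfold V; solve_continuous].
  intros u Hu; destruct (DXY u (proj1 Hu)) as [DX DY].
  unfold V; auto_derive; [repeat split; eexists; eauto |].
  rewrite (is_derive_unique (fun x : R => P x) _ _ (DP u)),
    (is_derive_unique (fun x : R => Q x) _ _ (DQ u)),
    (is_derive_unique (fun x : R => X x) _ _ DX),
    (is_derive_unique (fun x : R => Y x) _ _ DY); ring. }
assert (P0 : P 0 = 0) by apply (RInt_point (V := R_CompleteNormedModule)).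
assert (Q0 : Q 0 = 0) by apply (RInt_point (V := R_CompleteNormedModule)).
unfold U, V, X, Y, we in EU, EV.
rewrite Et, Rmax_left, H0, P0, Q0, exp_0, cos_0, sin_0 in EU, EV by lra.
pose proof (sin2_cos2 (Q t)) as SC; unfold Rsqr in SC.
pose proof (exp_pos (P t)) as EP.
set (c := cos (Q t)) in *; set (s := sin (Q t)) in *; set (e := exp (P t)) in *.
destruct (w t) as [x y], z0 as [x0 y0]; simpl in EU, EV.
unfold expi, Cmult; simpl; rewrite cos_neg, sin_neg, exp_Ropp; fold c s e.
replace x0 with (e * (x * c - y * s)) by lra.
replace y0 with (e * (x * s + y * c)) by lra.
f_equal.
- transitivity (x * (s * s + c * c)); [rewrite SC; ring | field; lra].
- transitivity (y * (s * s + c * c)); [rewrite SC; ring | field; lra].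
Qed.

(** The continuous argument theta = a - Q satisfies |theta'| <= -d'. Hence d + (theta - a) and d -
    (theta - a) are both nonincreasing, and both start at d(0, z0). *)
Lemma trajectory_polar_bound (z0 : C) (a : R) (w : R -> C) (t : R) :
  0 < Cmod z0 < 1 -> z0 = (Cmod z0 * expi a)%C -> trajectory z0 w -> 0 <= t ->
  exists theta,
    0 < Cmod (w t) < 1 /\ w t = (Cmod (w t) * expi theta)%C /\
    hyp_len (Cmod (w t)) + Rabs (theta - a) <= hyp_len (Cmod z0).
Proof.
intros Hz Ha Hw Ht.
destruct (trajectory_log z0 w Hw) as (P & Q & A & B & P0 & Q0 & DP & DQ & HPQ).
set (rho := fun t => Cmod z0 * exp (- P t)).
assert (Hpol : forall u, 0 <= u -> w u = (rho u * expi (a - Q u))%C).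
{ intros u Hu; destruct (HPQ u Hu) as (_ & -> & _).
  rewrite Ha at 1; unfold rho, expi, Cmult, Rminus; simpl.
  rewrite cos_plus, sin_plus; f_equal; ring. }
assert (Hrho : forall u, 0 < rho u).
{ intros u; apply Rmult_lt_0_compat; [lra | apply exp_pos]. }
assert (Hmod : forall u, 0 <= u -> Cmod (w u) = rho u).
{ intros u Hu; rewrite (Hpol u Hu); apply Cmod_polar; specialize (Hrho u); lra. }
assert (Hrho1 : forall u, 0 <= u -> rho u < 1).
{ intros u Hu; rewrite <- Hmod by easy; now apply HPQ. }
exists (a - Q t); rewrite Hmod by easy.
split; [split; auto | split; [auto |]].
assert (Drho : forall u, is_derive rho u (- A u * rho u)).
{ intros u; unfold rho; auto_derive; [eexists; apply DP |].
  rewrite (is_derive_unique (fun x : R => P x) _ _ (DP u)); ring. }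
(* The two signs together yield the absolute value in the conclusion. *)
assert (Hs : forall s, s = 1 \/ s = -1 ->
          hyp_len (rho t) + s * Q t <= hyp_len (rho 0) + s * Q 0).
{ intros s Hs.
  apply (nonpos_derive_le (fun t => hyp_len (rho t) + s * Q t)
           (fun u => - A u * rho u * (2 / (1 - rho u ^ 2)) + s * B u)); [easy |].
  intros u [Hu _]; specialize (Hrho u); specialize (Hrho1 u Hu); split.
  - apply (is_derive_plus (K := R_AbsRing) (V := R_NormedModule)).
    + apply (is_derive_comp hyp_len rho); [apply is_derive_hyp_len; lra | apply Drho].
    + now apply is_derive_scal.
  - destruct (HPQ u Hu) as (_ & _ & HB); rewrite Hmod in HB by easy.
    assert (H1 : 0 < 1 - rho u ^ 2) by nra.
    assert (H2 : s * B u <= Rabs (B u)).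
    { pose proof (Rle_abs (B u)); pose proof (Rle_abs (- B u)) as H3.
      rewrite Rabs_Ropp in H3; destruct Hs as [-> | ->]; lra. }
    apply Rle_trans with (- A u * rho u * (2 / (1 - rho u ^ 2)) + Rabs (B u)); [lra |].
    apply Rmult_le_reg_r with (1 := H1).
    field_simplify; lra. }
assert (Hs1 := Hs 1 (or_introl eq_refl)); assert (Hs2 := Hs (-1) (or_intror eq_refl)).
assert (Er : rho 0 = Cmod z0).
{ unfold rho; rewrite P0, Ropp_0, exp_0; ring. }
rewrite Er, Q0 in Hs1, Hs2.
replace (a - Q t - a) with (- Q t) by ring.
unfold Rabs; destruct Rcase_abs; lra.
Qed.

Lemma trajectory_from_0 (w : R -> C) (t : R) : trajectory 0 w -> 0 <= t -> w t = 0.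
Proof.
intros Hw Ht.
destruct (trajectory_log 0 w Hw) as (P & Q & A & B & _ & _ & _ & _ & H).
destruct (H t Ht) as (_ & -> & _); ring.
Qed.

(** * Arcs of the Archimedean spirals and the choice of arguments *)

Definition slope (s : pm_sign) : R := match s with Plus => 1 | Minus => -1 end.

(** Taking the distance x from 0 as parameter in place of the angle treats both signs at once. *)
Lemma spiral_arc_iff (s : pm_sign) (z0 : C) (a L : R) (u : C) :
  spiral_arc s z0 a L u <->
  exists x, 0 <= x /\ hyp_dist 0 z0 - L <= x <= hyp_dist 0 z0 /\
    u = (radius x * expi (a + slope s * (x - hyp_dist 0 z0)))%C.
Proof.
split.
- intros (phi & (z & Hz & -> & Hs) & Hphi).
  pose proof (Cmod_ge_0 z).
  exists (hyp_len (Cmod z)); rewrite radius_hyp_len by lra.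
  split; [now apply hyp_len_nonneg |].
  rewrite <- hyp_dist_0_len.
  destruct s; simpl; (split; [lra | do 2 f_equal; lra]).
- intros (x & Hx & HL & ->).
  exists (a + slope s * (x - hyp_dist 0 z0)); split; [| destruct s; simpl; lra].
  pose proof (radius_nonneg x Hx); pose proof (radius_lt_1 x).
  assert (E : Cmod (radius x) = radius x) by (rewrite Cmod_R; now apply Rabs_pos_eq).
  (* Only the modulus of the auxiliary point matters, so a real one is taken. *)
  exists (RtoC (radius x)).
  rewrite (hyp_dist_0_len (radius x)), E, hyp_len_radius.
  split; [easy | split; [easy |]]; destruct s; simpl; lra.
Qed.

(** Rotating u by -a and normalising leaves a unit vector v, whose argument is acos (Re v) up to the
    sign of Im v. *)
Lemma polar_form_near (u : C) (a : R) :
  u <> 0 -> exists theta, u = (Cmod u * expi theta)%C /\ Rabs (theta - a) <= PI.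
Proof.
intros Hu.
assert (Hm : 0 < Cmod u) by now apply Cmod_gt_0.
assert (HC : RtoC (Cmod u) <> 0) by (intros E; apply RtoC_inj in E; lra).
set (v := (u * expi (- a) / Cmod u)%C).
assert (Hv : Cmod v = 1).
{ unfold v; rewrite Cmod_div, Cmod_mult, Cmod_R, (Rabs_pos_eq (Cmod u)) by (easy || lra).
  rewrite <- (Cmult_1_l (expi _)), Cmod_polar by lra; field; lra. }
assert (Hv2 := Cmod_sqr v); rewrite Hv in Hv2.
assert (E : forall b, v = expi b -> u = (Cmod u * expi (a + b))%C).
{ intros b Hb.
  transitivity (Cmod u * (expi a * v))%C.
  - unfold v.
    transitivity (u * (expi a * expi (- a)))%C.
    + replace (expi a * expi (- a))%C with (RtoC 1); [ring |].
      unfold expi, Cmult; simpl; rewrite cos_neg, sin_neg.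
      pose proof (sin2_cos2 a); unfold Rsqr in *; unfold RtoC; f_equal; lra.
    + field; exact HC.
  - rewrite Hb; unfold expi, Cmult; simpl; rewrite cos_plus, sin_plus; f_equal; ring. }
assert (Hb : -1 <= fst v <= 1) by nra.
pose proof (acos_bound (fst v)).
assert (Es : sin (acos (fst v)) = Rabs (snd v)).
{ rewrite sin_acos by easy; rewrite <- sqrt_Rsqr_abs; f_equal; unfold Rsqr; lra. }
destruct (Rle_or_lt 0 (snd v)) as [Hs | Hs].
- exists (a + acos (fst v)); split.
  + apply E; unfold expi; rewrite cos_acos, Es, Rabs_pos_eq by easy.
    apply surjective_pairing.
  + apply Rabs_le; lra.
- exists (a + - acos (fst v)); split.
  + apply E; unfold expi; rewrite cos_neg, sin_neg, cos_acos, Es, Rabs_left by easy.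
    rewrite Ropp_involutive; apply surjective_pairing.
  + apply Rabs_le; lra.
Qed.

(** Half the difference, h, satisfies cos (2 h) = 1, hence sin h = 0, and |h| < PI leaves only h =
    0. *)
Lemma expi_injective (x y : R) : Rabs (x - y) < 2 * PI -> expi x = expi y -> x = y.
Proof.
intros Hxy E; injection E as Ec Es.
set (h := (x - y) / 2).
assert (Hh : - PI < h < PI) by (apply Rabs_def2 in Hxy; unfold h; lra).
assert (Hs : sin h * sin h = 0).
{ assert (H : cos (2 * h) = 1).
  { replace (2 * h) with (x - y) by (unfold h; field).
    rewrite cos_minus, Ec, Es; pose proof (sin2_cos2 y); unfold Rsqr in *; lra. }
  rewrite cos_2a_sin in H; lra. }
destruct (Rtotal_order h 0) as [L | [E0 | L]]; [| unfold h in E0; lra |].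
- pose proof (sin_gt_0 (- h)); rewrite sin_neg in *; nra.
- pose proof (sin_gt_0 h); nra.
Qed.

(** * Reachable points, unreachable points and the boundary *)

Lemma reachable_disk (z0 : C) (a : R) (u : C) :
  0 < Cmod z0 < 1 -> z0 = (Cmod z0 * expi a)%C -> u <> 0 -> Cmod u < 1 ->
  hyp_len (Cmod u) < hyp_len (Cmod z0) - PI -> reachable z0 u.
Proof.
intros Hz Ha Hu Hu1 Hlen.
destruct (polar_form_near u a Hu) as (theta & Eu & Hth).
apply Cmod_gt_0 in Hu.
remember (hyp_len (Cmod z0)) as d0 eqn:Ed0.
set (x := hyp_len (Cmod u)) in *.
pose proof PI_RGT_0.
assert (Hx : 0 < x) by (apply hyp_len_pos; lra).
(* The slope for which the spiral from z0 has argument theta at distance x; |theta - a| <= PI < d0 -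
   x bounds it by 1. *)
set (c := (theta - a) / (x - d0)).
assert (Hc : c ^ 2 <= 1).
{ rewrite <- Rsqr_pow2, <- Rsqr_1; apply Rsqr_le_abs_1.
  unfold c; rewrite Rabs_div, Rabs_R1, (Rabs_left (x - d0)) by lra.
  apply Rle_div_l; lra. }
(* The nonpositive root, for which [stretch k] takes every positive value. *)
set (k := - sqrt (1 - c ^ 2)).
assert (Hck : c ^ 2 + k ^ 2 = 1).
{ replace (k ^ 2) with (Rsqr (sqrt (1 - c ^ 2))) by (unfold k, Rsqr; ring).
  rewrite Rsqr_sqrt; lra. }
assert (Hk0 : k <= 0) by (pose proof (sqrt_pos (1 - c ^ 2)); unfold k; lra).
assert (Hk : -1 <= k <= 0) by (split; nra).
destruct (slope_distance k d0) as (d & Hd0 & Hp & Hi & Dd); [easy | lra |].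
exists (fun t => (radius (d t) * expi (a + c * (d t - d0)))%C).
exists (ln (stretch k d0 / stretch k x)).
assert (S1 := stretch_pos k d0 ltac:(lra)); assert (S2 := stretch_pos k x Hx).
assert (S3 : stretch k x < stretch k d0) by (apply stretch_increasing; lra).
split; [| split].
- apply slope_trajectory with k; auto; lra.
- rewrite <- ln_1; apply Rlt_le, ln_increasing; [lra |].
  apply Rlt_div_r; lra.
- replace (d _) with x.
  + unfold x at 1; rewrite radius_hyp_len by lra.
    replace (a + c * (x - d0)) with theta by (unfold c; field; lra).
    exact Eu.
  + apply (stretch_injective k); [lra |].
    rewrite Hi, exp_Ropp, exp_ln by (now apply Rdiv_lt_0_compat).
    field; lra.
Qed.

(** A trajectory ending there would supply an argument theta1 with |theta1 - a| <= d(0, z0) - x <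
    |theta - a| <= PI. Two arguments of one point that are less than 2 PI apart coincide, a
    contradiction. *)
Lemma far_unreachable (z0 : C) (a x theta : R) :
  0 < Cmod z0 < 1 -> z0 = (Cmod z0 * expi a)%C -> 0 < x ->
  hyp_len (Cmod z0) - x < Rabs (theta - a) <= PI ->
  ~ reachable z0 (radius x * expi theta)%C.
Proof.
intros Hz Ha Hx [Hfar Hpi] (w & t & Hw & Ht & E).
destruct (trajectory_polar_bound z0 a w t Hz Ha Hw Ht) as (theta1 & _ & E1 & Hb).
pose proof (radius_pos x Hx).
assert (Em : Cmod (w t) = radius x) by (rewrite <- E; apply Cmod_polar; lra).
rewrite Em, hyp_len_radius in Hb.
assert (Eth : theta = theta1).
{ apply expi_injective.
  - replace (theta - theta1) with ((theta - a) + - (theta1 - a)) by ring.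
    apply Rle_lt_trans with (1 := Rabs_triang _ _); rewrite Rabs_Ropp; lra.
  - replace (expi theta) with (/ radius x * (radius x * expi theta))%C.
    + rewrite E, E1, Em; field.
      intros E0; apply RtoC_inj in E0; lra.
    + field; intros E0; apply RtoC_inj in E0; lra. }
subst; lra.
Qed.

(** Increasing x while keeping theta makes the lower bound on |theta - a| strict, so unreachable
    points lie arbitrarily close. *)
Lemma reachable_boundary_point (z0 : C) (a x theta : R) :
  0 < Cmod z0 < 1 -> z0 = (Cmod z0 * expi a)%C -> 0 < x ->
  hyp_len (Cmod z0) - x <= Rabs (theta - a) <= PI ->
  reachable z0 (radius x * expi theta)%C ->
  boundary_point (reachable z0) (radius x * expi theta)%C.
Proof.
intros Hz Ha Hx Hth Hr P HP.
split; [exists (radius x * expi theta)%C; split; [now apply locally_singleton | easy] |].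
assert (HF : filterlim (fun e => (radius (x + e) * expi theta)%C) (locally 0)
               (locally (T := C_UniformSpace) (radius x * expi theta)%C)).
{ rewrite polar_pair.
  apply (filterlim_ext (fun e => (radius (x + e) * cos theta, radius (x + e) * sin theta)));
    [intros e; symmetry; apply polar_pair |].
  assert (Hc : forall b, filterlim (fun e => radius (x + e) * b) (locally 0)
                 (locally (radius x * b))).
  { intros b; replace (radius x * b) with (radius (x + 0) * b) by now rewrite Rplus_0_r.
    apply (ex_derive_continuous (V := R_NormedModule) (fun e => radius (x + e) * b)).
    auto_derive; eexists; apply is_derive_radius. }
  apply filterlim_C_pair; [apply locally_filter | apply Hc | apply Hc]. }
destruct (HF P HP) as [eps He].
exists (radius (x + eps / 2) * expi theta)%C.
pose proof (cond_pos eps); split.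
- apply He.
  unfold ball; simpl; unfold AbsRing_ball, abs, minus, plus, opp; simpl.
  rewrite Rabs_pos_eq; lra.
- apply far_unreachable with a; auto; lra.
Qed.

Lemma locally_punctured_disk (u : C) (r : R) :
  u <> 0 -> Cmod u < r -> locally u (fun v : C => v <> 0 /\ Cmod v < r).
Proof.
intros Hu Hr; apply Cmod_gt_0 in Hu.
apply locally_C.
assert (He : 0 < Rmin (Cmod u) (r - Cmod u)) by (apply Rmin_pos; lra).
exists (mkposreal _ He); intros v Hv.
change (Cmod (v - u) < Rmin (Cmod u) (r - Cmod u)) in Hv.
pose proof (Rmin_l (Cmod u) (r - Cmod u)); pose proof (Rmin_r (Cmod u) (r - Cmod u)).
split.
- intros ->; replace (0 - u)%C with (- u)%C in Hv by ring.
  rewrite Cmod_opp in Hv; lra.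
- replace v with (u + (v - u))%C by ring.
  apply Rle_lt_trans with (1 := Cmod_triangle _ _); lra.
Qed.

Lemma hyp_len_lt_radius (r x : R) : 0 <= r < 1 -> r < radius x <-> hyp_len r < x.
Proof.
intros Hr; rewrite <- (radius_hyp_len r) at 1 by easy.
split; [| apply radius_increasing].
intros H; apply Rnot_le_lt; intros [L | ->]; [apply radius_increasing in L |]; lra.
Qed.

(** The punctured disk of hyperbolic radius d(0, z0) - PI about 0 is open, contains u and consists
    of reachable points. Its centre is removed because no trajectory from z0 <> 0 attains 0. *)
Lemma close_not_boundary_point (z0 : C) (a : R) (u : C) :
  0 < Cmod z0 < 1 -> z0 = (Cmod z0 * expi a)%C -> u <> 0 -> Cmod u < 1 ->
  hyp_len (Cmod u) < hyp_len (Cmod z0) - PI -> ~ boundary_point (reachable z0) u.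
Proof.
intros Hz Ha Hu Hu1 Hlen Hb.
pose proof (Cmod_ge_0 u).
apply hyp_len_lt_radius in Hlen; [| lra].
destruct (Hb _ (locally_punctured_disk u _ Hu Hlen)) as [_ (v & [Hv Hvr] & Hn)].
apply Hn.
pose proof (radius_lt_1 (hyp_len (Cmod z0) - PI)); pose proof (Cmod_ge_0 v).
apply reachable_disk with a; try easy; [lra |].
apply hyp_len_lt_radius in Hvr; lra.
Qed.

(** * The initial value 0 *)

Lemma trajectory_const_0 : trajectory 0 (fun _ => 0%C).
Proof.
exists (fun _ => 1%C); split; [split | split].
- intros t _; apply filterlim_const.
- intros t _; apply Cmod_1.
- easy.
- intros t Ht; split; [rewrite Cmod_0; lra |].
  replace (- 0 * ((1 + 0) / (1 - 0)))%C with (RtoC 0) by (field; intros E; injection E; lra).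
  apply (is_derive_half_line_pair (fun _ => 0) (fun _ => 0) t 0 0 Ht);
    exact (is_derive_const _ _).
Qed.

(** The reachable set is the single point 0, so any nonzero point nearby lies outside it. *)
Lemma boundary_point_reachable_0 : boundary_point (reachable 0) 0.
Proof.
intros P HP; split.
- exists 0%C; split; [now apply locally_singleton |].
  exists (fun _ => 0%C), 0; repeat split; [apply trajectory_const_0 | lra].
- apply locally_C in HP; destruct HP as [eps He].
  pose proof (cond_pos eps).
  exists (RtoC (eps / 2)); split.
  + apply He; change (Cmod (RtoC (eps / 2) - 0) < eps).
    replace (RtoC (eps / 2) - 0)%C with (RtoC (eps / 2)) by ring.
    rewrite Cmod_R, Rabs_pos_eq; lra.
  + intros (w & t & Hw & Ht & E).
    rewrite (trajectory_from_0 w t Hw Ht) in E; apply RtoC_inj in E; lra.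
Qed.

(** * The two Archimedean spirals and their optimal times *)

(** Slopes c = 1 and c = -1 force k = 0. The time to reach distance x is then ln (sinh d0 / sinh x),
    which is [Tmax] for x = d0 - PI. *)
Lemma stretch_zero_slope (x : R) : stretch 0 x = sinh x.
Proof. unfold stretch; rewrite Ropp_0, Rmult_0_l, exp_0; ring. Qed.

Lemma radius_expi_neq_0 (x phi : R) : 0 < x -> (radius x * expi phi)%C <> 0.
Proof.
intros Hx E; pose proof (radius_pos x Hx).
apply (f_equal Cmod) in E; rewrite Cmod_0, Cmod_polar in E; lra.
Qed.

Theorem theorem1p4 :
  forall (z0 : C) (a : R),
    Cmod z0 < 1 ->
    z0 = (Cmod z0 * expi a)%C ->
    exists w : pm_sign -> R -> C,
      forall s : pm_sign,
        trajectory z0 (w s) /\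
        (forall u : C,
           (exists t, 0 <= t /\ u = w s t) <-> spiral_to_origin s z0 a u) /\
        (hyp_dist 0 z0 <= PI ->
           (forall t, 0 < t -> optimal z0 (w s) t) /\
           (z0 <> 0 ->
            forall u : C,
              (exists t, 0 <= t /\ u = w s t) <->
              gamma s z0 a u /\ u <> 0)) /\
        (hyp_dist 0 z0 > PI ->
           (forall T, 0 < T <= Tmax z0 -> optimal z0 (w s) T) /\
           (forall T, T > Tmax z0 -> ~ optimal z0 (w s) T) /\
           (forall u : C,
              (exists t, 0 <= t <= Tmax z0 /\ u = w s t) <->
              gamma s z0 a u)).
Proof.
intros z0 a Hz1 Ha.
pose proof PI_RGT_0 as HPI.
destruct (Ceq_dec z0 0) as [-> | Hz0].
{ assert (E0 : hyp_dist 0 0 = 0) by (rewrite hyp_dist_0_len, Cmod_0; apply hyp_len_0).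
  exists (fun _ _ => 0%C); intros s.
  split; [apply trajectory_const_0 |].
  split; [| split; intros H; [| lra]].
  - intros u; unfold spiral_to_origin; rewrite spiral_arc_iff, E0; split.
    + intros (t & _ & ->); split; [| easy].
      exists 0; rewrite radius_0; split; [lra | split; [lra | ring]].
    + intros [(x & Hx & Hx0 & ->) _].
      exists 0; split; [lra |].
      replace x with 0 by lra; rewrite radius_0; ring.
  - split; [| easy].
    intros t _; apply boundary_point_reachable_0. }
assert (Hz : 0 < Cmod z0 < 1) by (split; [now apply Cmod_gt_0 | easy]).
unfold Tmax; remember (hyp_dist 0 z0) as d0 eqn:Ed0.
assert (Ed := Ed0); rewrite hyp_dist_0_len in Ed.
assert (Hd0 : 0 < d0) by (rewrite Ed; now apply hyp_len_pos).
(* Since k = 0 for both signs, one function [d] serves both trajectories. *)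
destruct (slope_distance 0 d0) as (d & Hd & Hp & Hi & Dd); [lra | easy |].
assert (Hi' : forall t, sinh (d t) = exp (- t) * sinh d0).
{ intros t; specialize (Hi t); now rewrite !stretch_zero_slope in Hi. }
assert (HS := sinh_pos d0 Hd0).
assert (Hdle : forall t x, sinh x = exp (- t) * sinh d0 -> d t = x).
{ intros t x Hx; rewrite <- Hi' in Hx.
  now rewrite <- (arcsinh_sinh (d t)), <- Hx, arcsinh_sinh. }
assert (Hmono : forall t t', t < t' -> d t' < d t).
{ intros t t' Htt; rewrite <- (arcsinh_sinh (d t')), <- (arcsinh_sinh (d t)), !Hi'.
  apply arcsinh_lt, Rmult_lt_compat_r; [easy | apply exp_increasing; lra]. }
assert (Hsurj : forall x, 0 < x <= d0 -> exists t, 0 <= t /\ d t = x).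
{ intros x Hx; assert (Hsx := sinh_pos x (proj1 Hx)).
  set (t := - ln (sinh x / sinh d0)).
  assert (Et : d t = x).
  { apply Hdle; unfold t; rewrite Ropp_involutive, exp_ln by now apply Rdiv_lt_0_compat.
    field; lra. }
  exists t; split; [| easy].
  apply Rnot_lt_le; intros L; apply Hmono in L; lra. }
assert (Hrange : forall t, 0 <= t -> 0 < d t <= d0).
{ intros t [Ht | <-]; [| lra].
  apply Hmono in Ht; split; [apply Hp | lra]. }
exists (fun s t => (radius (d t) * expi (a + slope s * (d t - d0)))%C); intros s.
assert (Hs : slope s = 1 \/ slope s = -1) by (destruct s; simpl; lra).
assert (Htraj : trajectory z0 (fun t => (radius (d t) * expi (a + slope s * (d t - d0)))%C)).
{ apply slope_trajectory with 0; auto; try lra; [destruct Hs as [-> | ->]; lra]. }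
assert (Habs : forall t, 0 <= t -> Rabs (a + slope s * (d t - d0) - a) = d0 - d t).
{ intros t Ht; specialize (Hrange t Ht).
  destruct Hs as [-> | ->]; [rewrite Rabs_left1 | rewrite Rabs_pos_eq]; lra. }
(* The times with d t >= p trace the arc of length d0 - p without 0. Here p = 0 gives the whole
   trajectory and p = d0 - PI the part up to [Tmax]. *)
assert (Himage : forall (p : R) (q : R -> Prop) (u : C),
  (forall t, 0 <= t -> q t <-> p <= d t) ->
  (exists t, (0 <= t /\ q t) /\
     u = (radius (d t) * expi (a + slope s * (d t - d0)))%C) <->
  spiral_arc s z0 a (d0 - p) u /\ u <> 0).
{ intros p q u Hq; rewrite spiral_arc_iff, <- Ed0; split.
  - intros (t & [Ht Hqt] & ->); specialize (Hrange t Ht); apply Hq in Hqt; [| easy].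
    split; [| now apply radius_expi_neq_0].
    exists (d t); split; [lra | split; [lra | easy]].
  - intros [(x & Hx & Hxp & ->) Hu].
    destruct (Req_dec x 0) as [-> | Hx0]; [exfalso; apply Hu; rewrite radius_0; ring |].
    destruct (Hsurj x) as (t & Ht & <-); [lra |].
    exists t; split; [| easy]; split; [easy | apply Hq; lra]. }
(* The angle turned is exactly d0 - d t, so the lower bound in [reachable_boundary_point] is an
   equality and only the bound PI is a condition. *)
assert (Hopt : forall t, 0 <= t -> d0 - d t <= PI ->
  optimal z0 (fun t => (radius (d t) * expi (a + slope s * (d t - d0)))%C) t).
{ intros t Ht Hpi; apply reachable_boundary_point with a; auto.
  - rewrite Habs, <- Ed; lra.
  - exists (fun t => (radius (d t) * expi (a + slope s * (d t - d0)))%C), t; auto. }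
assert (Hall : forall u : C,
  (exists t, 0 <= t /\ u = (radius (d t) * expi (a + slope s * (d t - d0)))%C) <->
  spiral_arc s z0 a d0 u /\ u <> 0).
{ intros u; replace (spiral_arc s z0 a d0 u) with (spiral_arc s z0 a (d0 - 0) u)
    by (f_equal; ring).
  rewrite <- (Himage 0 (fun _ => True)).
  - split; intros (t & Ht & E); exists t; tauto.
  - intros t Ht; split; [intros _; left; apply Hp | easy]. }
split; [easy |]; split; [| split; intros Hpi].
- intros u; unfold spiral_to_origin; rewrite <- Ed0, Hall; tauto.
- split; [intros t Ht; apply Hopt; [| specialize (Hp t)]; lra |].
  intros _ u; unfold gamma; rewrite <- Ed0, Rmin_left by easy; apply Hall.
- set (T := - ln (sinh (d0 - PI) / sinh d0)).
  assert (HS1 := sinh_pos (d0 - PI) ltac:(lra)).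
  assert (ET : d T = d0 - PI).
  { apply Hdle; unfold T; rewrite Ropp_involutive, exp_ln by now apply Rdiv_lt_0_compat.
    field; lra. }
  assert (HT : forall t, t <= T <-> d0 - PI <= d t).
  { intros t; rewrite <- ET; split; intros L.
    - destruct L as [L | ->]; [apply Hmono in L |]; lra.
    - apply Rnot_lt_le; intros L'; apply Hmono in L'; lra. }
  split; [| split].
  + intros t [Ht HtT]; apply HT in HtT; apply Hopt; lra.
  + intros t Ht; specialize (Hp t).
    (* After [Tmax] the point has entered the punctured disk of reachable points. *)
    assert (Hdt : d t < d0 - PI) by (apply Rnot_le_lt; rewrite <- HT; lra).
    pose proof (radius_pos _ Hp); pose proof (radius_lt_1 (d t)).
    apply close_not_boundary_point with a; auto.
    * now apply radius_expi_neq_0.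
    * rewrite Cmod_polar; lra.
    * rewrite Cmod_polar, hyp_len_radius, <- Ed; lra.
  + intros u; unfold gamma; rewrite <- Ed0, Rmin_right by lra.
    replace PI with (d0 - (d0 - PI)) by ring.
    split.
    * intros H; apply (Himage _ (fun t => t <= T)); [intros; apply HT | easy].
    * intros H; apply (Himage (d0 - PI) (fun t => t <= T)); [intros; apply HT |].
      split; [easy |].
      (* This arc stops at distance d0 - PI > 0, so it does not contain 0. *)
      apply spiral_arc_iff in H; destruct H as (x & _ & Hx & ->).
      apply radius_expi_neq_0; lra.
Qed.
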